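(* There is a bounded linear operator on $\ell_\infty/c_0$ which is locally null, factors through $\ell_\infty$, and is surjective. There is no surjective weakly compact operator on $\ell_\infty/c_0$.
   Context: Operators are bounded and linear. For infinite $A\subseteq\mathbb{N}$, $I_A:\ell_\infty(A)/c_0(A)\rightarrow\ell_\infty/c_0$ is given by $I_A([g])=[g\cup 0_{\mathbb{N}\setminus A}]$ (extension by zero). An operator $T:\ell_\infty/c_0\rightarrow\ell_\infty/c_0$ is locally null if for every infinite $A\subseteq\mathbb{N}$ there is an infinite $A_1\subseteq A$ such that $T\circ I_{A_1}=0$. $T$ factors through $\ell_\infty$ if $T=R_2\circ R_1$ for some operators $R_1:\ell_\infty/c_0\rightarrow\ell_\infty$ and $R_2:\ell_\infty\rightarrow\ell_\infty/c_0$. *)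

(* Defs.v *)
From HB Require Import structures.
From mathcomp Require Import all_boot all_order all_algebra.
From mathcomp Require Import generic_quotient ring_quotient.
From mathcomp Require Import all_classical all_reals all_analysis.

Set Implicit Arguments.
Unset Strict Implicit.
Unset Printing Implicit Defensive.

Import Order.TTheory GRing.Theory Num.Theory.
Import numFieldNormedType.Exports.

Local Open Scope classical_set_scope.
Local Open Scope ring_scope.

Section linf.
Context (R : realType) (I : Type).

Definition bounded_pred : {pred I -> R} :=
  mem [set f : I -> R | bounded_fun (f : I -> R^o)].

Lemma bounded_predP (f : I -> R) :
  reflect (exists M, forall i, `|f i| <= M) (f \in bounded_pred).
Proof.
apply: (iffP idP) => [|[M fM]].
  rewrite inE => -[M [Mr fM]]; exists (M + 1) => i.
  by apply: fM => //; rewrite ltrDl.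
rewrite inE; exists M; split; first exact: num_real.
by move=> N MN i _ /=; exact: le_trans (fM i) (ltW MN).
Qed.

Lemma bounded_submod_closed : submod_closed bounded_pred.
Proof.
split=> [|a f g /bounded_predP[M fM] /bounded_predP[N gN]].
  by apply/bounded_predP; exists 0 => i; rewrite normr0.
apply/bounded_predP; exists (`|a| * M + N) => i.
by rewrite (le_trans (ler_normD _ _))// lerD// normrM ler_wpM2l.
Qed.

HB.instance Definition _ :=
  GRing.isSubmodClosed.Build R (I -> R) bounded_pred bounded_submod_closed.

Record linf := Linf {
  linf_fun :> I -> R ;
  linf_bounded : linf_fun \in bounded_pred }.

HB.instance Definition _ := [isSub for linf_fun].
HB.instance Definition _ := [Choice of linf by <:].
HB.instance Definition _ := [SubChoice_isSubLmodule of linf by <:].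

(* [sup set0 = 0] gives the zero norm when [I] is empty. *)
Definition linf_norm (f : linf) : R := sup (range (fun i => `|f i|)).

Lemma linf_norm_ub (f : linf) i : `|f i| <= linf_norm f.
Proof.
apply: ub_le_sup; last by exists i.
by have /bounded_predP[M fM] := linf_bounded f; exists M => _ [j _ <-].
Qed.

Lemma linf_norm_le (f : linf) (M : R) :
  0 <= M -> (forall i, `|f i| <= M) -> linf_norm f <= M.
Proof.
move=> M0 fM; rewrite /linf_norm.
have [->|/set0P E] := eqVneq (range (fun i => `|f i|)) set0; first by rewrite sup0.
by apply: ge_sup => // _ [i _ <-].
Qed.

Lemma linf_norm_ge0 (f : linf) : 0 <= linf_norm f.
Proof.
have [e|/set0P[_ [i _ _]]] := eqVneq (range (fun i => `|f i|)) set0.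
  by rewrite /linf_norm e sup0.
exact: le_trans (normr_ge0 _) (linf_norm_ub f i).
Qed.

Lemma linf_normD (f g : linf) :
  linf_norm (f + g) <= linf_norm f + linf_norm g.
Proof.
apply: linf_norm_le => [|i]; first by rewrite addr_ge0 ?linf_norm_ge0.
by rewrite (le_trans (ler_normD _ _))// lerD ?linf_norm_ub.
Qed.

Let linf_normZ_le (a : R) (f : linf) :
  linf_norm (a *: f) <= `|a| * linf_norm f.
Proof.
apply: linf_norm_le => [|i]; first by rewrite mulr_ge0 ?linf_norm_ge0.
by rewrite normrM ler_wpM2l ?linf_norm_ub.
Qed.

Lemma linf_normZ (a : R) (f : linf) : linf_norm (a *: f) = `|a| * linf_norm f.
Proof.
apply/le_anti; rewrite linf_normZ_le /=.
have [->|a0] := eqVneq a 0; first by rewrite normr0 mul0r linf_norm_ge0.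
rewrite -ler_pdivlMl ?normr_gt0// -normfV.
by rewrite -{1}[f](scalerK a0) linf_normZ_le.
Qed.

Lemma linf_norm_eq0 (f : linf) : linf_norm f = 0 -> f = 0.
Proof.
move=> f0; apply/val_inj/funext => i /=; apply/eqP.
by rewrite -normr_le0 -f0 linf_norm_ub.
Qed.

HB.instance Definition _ :=
  Lmodule_isNormed.Build R linf linf_normD linf_normZ linf_norm_eq0.

(* Vanishing at infinity on the discrete set [I]; on [nat] this is convergence
   to 0, see [c0_natP]. *)
Definition c0_pred : {pred linf} :=
  mem [set f : linf | forall e : R, 0 < e -> finite_set [set i | e <= `|f i|]].

Lemma c0_submod_closed : submod_closed c0_pred.
Proof.
split=> [|a f g].
  rewrite inE => e e0; apply: (sub_finite_set _ (finite_set0 I)) => i /=.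
  by rewrite normr0 leNgt e0.
rewrite !inE => f0 g0 e e0.
have d0 : 0 < e / 2 by rewrite divr_gt0.
have b0 : 0 < `|a| + 1 by rewrite ltr_wpDl.
apply: (@sub_finite_set _ _ ([set i | e / 2 / (`|a| + 1) <= `|f i|] `|`
    [set i | e / 2 <= `|g i|])); last first.
  by rewrite finite_setU; split; [apply/f0/divr_gt0|exact: g0].
move=> i /= ei; apply: contrapT => /not_orP[/negP + /negP].
rewrite -!ltNge ltr_pdivlMr// => fi gi.
suff : `|a * f i + g i| < e by rewrite ltNge ei.
rewrite (le_lt_trans (ler_normD _ _))// [ltRHS]splitr ler_ltD//.
rewrite normrM mulrC (le_trans _ (ltW fi))// ler_wpM2l// lerDl//.
Qed.

HB.instance Definition _ :=
  GRing.isSubmodClosed.Build R linf c0_pred c0_submod_closed.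

Definition linf_c0 := Quotient.quot c0_pred.

HB.instance Definition _ := GRing.Zmodule.on linf_c0.
HB.instance Definition _ := EqQuotient.on linf_c0.

Definition linf_class (f : linf) : linf_c0 := \pi_linf_c0%qT f.

Lemma linf_classP (f g : linf) :
  reflect (linf_class f = linf_class g) (f - g \in c0_pred).
Proof. by rewrite Quotient.idealrBE; exact: eqP. Qed.

Lemma linf_class_surj (q : linf_c0) : exists f, q = linf_class f.
Proof. by exists (repr q); rewrite /linf_class reprK. Qed.

Lemma linf_classD (f g : linf) :
  linf_class (f + g) = linf_class f + linf_class g.
Proof. exact: Quotient.pi_add. Qed.

Definition linf_c0_scale (a : R) (q : linf_c0) : linf_c0 :=
  linf_class (a *: repr q).

Lemma linf_classZ (a : R) (f : linf) :
  linf_class (a *: f) = linf_c0_scale a (linf_class f).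
Proof.
apply/linf_classP; rewrite -scalerBr rpredZ//; apply/linf_classP.
by rewrite /linf_class reprK.
Qed.

Let scaleA a b q : linf_c0_scale a (linf_c0_scale b q) = linf_c0_scale (a * b) q.
Proof. by have [f ->] := linf_class_surj q; rewrite -!linf_classZ scalerA. Qed.

Let scale1 : left_id 1 linf_c0_scale.
Proof.
by move=> q; have [f ->] := linf_class_surj q; rewrite -linf_classZ scale1r.
Qed.

Let scaleDr : right_distributive linf_c0_scale +%R.
Proof.
move=> a p q; have [f ->] := linf_class_surj p; have [g ->] := linf_class_surj q.
by rewrite -linf_classD -!linf_classZ -linf_classD scalerDr.
Qed.

Let scaleDl q : {morph linf_c0_scale^~ q : a b / a + b}.
Proof.
move=> a b; have [f ->] := linf_class_surj q.
by rewrite -!linf_classZ -linf_classD scalerDl.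
Qed.

HB.instance Definition _ := GRing.Zmodule_isLmodule.Build R linf_c0
  scaleA scale1 scaleDr scaleDl.

Definition linf_c0_norm (q : linf_c0) : R :=
  inf [set `|f| | f in [set f : linf | linf_class f = q]].

Lemma linf_c0_norm_lb (f : linf) : linf_c0_norm (linf_class f) <= `|f|.
Proof. by apply: ge_inf; [exists 0 => _ [g _ <-]|exists f]. Qed.

Lemma linf_c0_norm_adherent (q : linf_c0) (e : R) : 0 < e ->
  exists2 f : linf, linf_class f = q & `|f| < linf_c0_norm q + e.
Proof.
move=> e0; have [|_ [f fq <-] fe] := @inf_adherent _
  [set `|f| | f in [set f : linf | linf_class f = q]] e e0; last by exists f.
split; last by exists 0 => _ [g _ <-].
by have [f ->] := linf_class_surj q; exists `|f|; exists f.
Qed.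

Lemma linf_c0_norm_ge0 (q : linf_c0) : 0 <= linf_c0_norm q.
Proof.
apply: lb_le_inf => [|_ [g _ <-]//].
by have [f ->] := linf_class_surj q; exists `|f|; exists f.
Qed.

Lemma linf_c0_normD (p q : linf_c0) :
  linf_c0_norm (p + q) <= linf_c0_norm p + linf_c0_norm q.
Proof.
apply/ler_addgt0Pr => e e0; have d0 : 0 < e / 2 by rewrite divr_gt0.
have [f <- fe] := linf_c0_norm_adherent p d0.
have [g <- ge] := linf_c0_norm_adherent q d0.
rewrite -linf_classD (le_trans (linf_c0_norm_lb _))//.
by rewrite (le_trans (ler_normD _ _))// [in leRHS](splitr e) addrACA lerD// ltW.
Qed.

Let linf_c0_normZ_le (a : R) (q : linf_c0) :
  linf_c0_norm (a *: q) <= `|a| * linf_c0_norm q.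
Proof.
have b0 : 0 < `|a| + 1 by rewrite ltr_wpDl.
apply/ler_addgt0Pr => e e0; have d0 : 0 < e / (`|a| + 1) by rewrite divr_gt0.
have [f <- fe] := linf_c0_norm_adherent q d0.
rewrite -[_ *: _]linf_classZ (le_trans (linf_c0_norm_lb _))// normrZ.
rewrite (le_trans (ler_wpM2l (normr_ge0 a) (ltW fe)))// mulrDr lerD2l.
by rewrite mulrCA ler_piMr ?ltW// ltr_pdivrMr// mul1r ltrDl.
Qed.

Lemma linf_c0_normZ (a : R) (q : linf_c0) :
  linf_c0_norm (a *: q) = `|a| * linf_c0_norm q.
Proof.
apply/le_anti; rewrite linf_c0_normZ_le /=.
have [->|a0] := eqVneq a 0; first by rewrite normr0 mul0r linf_c0_norm_ge0.
rewrite -ler_pdivlMl ?normr_gt0// -normfV.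
by rewrite -{1}[q](scalerK a0) linf_c0_normZ_le.
Qed.

Lemma linf_c0_norm_eq0 (q : linf_c0) : linf_c0_norm q = 0 -> q = 0.
Proof.
move=> q0; have [f qf] := linf_class_surj q.
suff : f - 0 \in c0_pred.
  by move/linf_classP; rewrite -qf => ->; rewrite /linf_class piE.
rewrite subr0 inE => e e0; have d0 : 0 < e / 2 by rewrite divr_gt0.
have [g] := linf_c0_norm_adherent q d0.
rewrite q0 add0r qf => /esym/linf_classP; rewrite inE => /(_ _ d0) fg ge.
apply: sub_finite_set fg => i /= ei.
have gi : `|g i| <= e / 2 by exact: le_trans (linf_norm_ub g i) (ltW ge).
have := lerB_dist (f i) (g i); apply: le_trans.
by rewrite lerBrDl (le_trans _ ei)// [leRHS]splitr lerD2r.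
Qed.

HB.instance Definition _ := Lmodule_isNormed.Build R linf_c0
  linf_c0_normD linf_c0_normZ linf_c0_norm_eq0.

End linf.
Arguments linf R I%_type.
Arguments linf_c0 R I%_type.

Lemma c0_natP (R : realType) (f : linf R nat) :
  f \in @c0_pred R nat <-> (f : nat -> R) @ \oo --> (0 : R).
Proof.
rewrite inE; split=> [f0|/cvgr0Pnorm_lt f0 e e0].
  apply/cvgr0Pnorm_lt => e e0; have /finite_seqP[s es] := f0 e e0.
  exists (\max_(i <- s) i).+1 => // n /= sn; rewrite ltNge; apply/negP => en.
  have : n \in s by have : [set i | e <= `|f i|] n by []; rewrite es.
  move=> ns; have := @leq_bigmax_seq _ s xpredT id n ns isT.
  by rewrite leqNgt sn.
have [N _ fN] := f0 e e0; apply: sub_finite_set (finite_II N) => i /= ei.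
by rewrite ltnNge; apply/negP => /fN /=; rewrite ltNge ei.
Qed.

Section zero_extension.
Context (R : realType) (A : set nat).

Definition zero_ext_fun (f : A -> R) : nat -> R := 'valL_0 f.

Lemma zero_ext_in (f : A -> R) (x : A) : zero_ext_fun f (val x) = f x.
Proof. exact: (congr1 (@^~ x) (valLK 0 f)). Qed.

Lemma zero_ext_notin (f : A -> R) (n : nat) : ~ A n -> zero_ext_fun f n = 0.
Proof.
by move=> An; rewrite /zero_ext_fun /valL_/= oinv_set_val insubN// notin_setE.
Qed.

Lemma zero_ext_bounded (f : linf R A) : zero_ext_fun f \in @bounded_pred R nat.
Proof.
apply/bounded_predP; exists `|f| => n; have [An|An] := pselect (A n).
  have -> : n = val (SigSub (mem_set An)) by [].
  by rewrite zero_ext_in; exact: linf_norm_ub.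
by rewrite zero_ext_notin// normr0.
Qed.

Definition zero_ext (f : linf R A) : linf R nat := Linf (zero_ext_bounded f).

(* [zero_ext_c0E] shows that the result does not depend on the representative
   chosen by [repr]. *)
Definition zero_ext_c0 (q : linf_c0 R A) : linf_c0 R nat :=
  linf_class (zero_ext (repr q)).

Lemma zero_ext_c0E (f : linf R A) :
  zero_ext_c0 (linf_class f) = linf_class (zero_ext f).
Proof.
apply/linf_classP; have : repr (linf_class f) - f \in @c0_pred R A.
  by apply/linf_classP; rewrite /linf_class reprK.
set g := repr _; rewrite !inE => fg e e0.
apply: (@sub_finite_set _ _ (val @` [set x : A | e <= `|(g - f) x|])); last first.
  exact/finite_image/fg.
move=> n /=; rewrite -[(_ - _) n]/(zero_ext_fun g n - zero_ext_fun f n).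
have [An|An] := pselect (A n); last first.
  by rewrite !zero_ext_notin// subrr normr0 leNgt e0.
have nE : n = val (SigSub (mem_set An)) by [].
by rewrite {1 2}nE !zero_ext_in => ge; exists (SigSub (mem_set An)).
Qed.

End zero_extension.
Arguments zero_ext_c0 R A q : clear implicits.

Section operators.
Context (R : realType).

Definition locally_null (T : linf_c0 R nat -> linf_c0 R nat) : Prop :=
  forall A : set nat, infinite_set A ->
    exists A1 : set nat, [/\ A1 `<=` A, infinite_set A1 &
      T \o zero_ext_c0 R A1 = cst 0].

Definition factors_through_linf (T : linf_c0 R nat -> linf_c0 R nat) : Prop :=
  exists (R1 : {linear linf_c0 R nat -> linf R nat})
         (R2 : {linear linf R nat -> linf_c0 R nat}),
    [/\ bounded_fun_norm R1, bounded_fun_norm R2 & T = R2 \o R1].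

Definition dual (V : normedModType R) :=
  {phi : {linear V -> R^o} | bounded_fun_norm phi}.

HB.instance Definition _ (V : normedModType R) := gen_eqMixin (dual V).
HB.instance Definition _ (V : normedModType R) := gen_choiceMixin (dual V).

(* [V] with its weak topology, the coarsest one making every bounded
   functional continuous. *)
Definition weak (V : normedModType R) :=
  initial_topology
    ((fun x phi => sval phi x) : V -> {ptws dual V -> R^o}).

HB.instance Definition _ (V : normedModType R) := Topological.on (weak V).

Lemma dual_weak_continuous (V : normedModType R) (phi : dual V) :
  continuous (sval phi : weak V -> R^o).
Proof.
move=> x; apply: (@continuous_comp (weak V) {ptws dual V -> R^o} R^o
  (fun x phi => sval phi x) (@proj _ (fun=> R^o) phi)).
  exact: initial_continuous.
exact: proj_continuous.
Qed.

Definition weakly_compact (V W : normedModType R) (T : V -> W) : Prop :=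
  compact (closure ([set T x | x in [set x : V | `|x| <= 1]] : set (weak W))).

End operators.

(* Main.v *)
From HB Require Import structures.
Require Import Defs.
From mathcomp Require Import all_boot all_order all_algebra.
From mathcomp Require Import all_classical all_reals all_analysis.

Set Implicit Arguments.
Unset Strict Implicit.
Unset Printing Implicit Defensive.

Import Order.TTheory GRing.Theory Num.Theory.
Import numFieldNormedType.Exports.

Local Open Scope classical_set_scope.
Local Open Scope ring_scope.

(** Write [X] for l_oo/c_0. Split the natural numbers into infinitely many
infinite fibres and choose on the [n]-th fibre a free ultrafilter [U n]. Limits
of bounded sequences along a free ultrafilter ignore c_0, so
[q |-> (lim_(U n) q)_n] is a contraction [fiber_lim : X -> l_oo]. Repeating the
[n]-th entry of a sequence along the [n]-th fibre gives a contraction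
[inflate : l_oo -> X], which is a right inverse of [fiber_lim] ([inflateK]); in
particular [fiber_lim] is onto.

The operator of the first part is [fiber_lim] followed by the quotient map
l_oo -> [X]; it factors through l_oo and is onto by construction. It is locally
null because an infinite set [A] contains a continuum of almost disjoint
infinite subsets, while a free ultrafilter contains at most one member of an
almost disjoint family: countably many ultrafilters leave some infinite subset
of [A] outside all of them ([ultra_avoid]), and every limit of a sequence
supported there is zero.

For the second part, let [T] be onto and let [K] be the weak closure of the
image of its unit ball. If [K] were weakly compact, the norm closed sets of all
[h] in l_oo with [inflate h / n.+1] in [K] would cover l_oo, and by Baire one of
them would contain a ball. So [K] would contain [inflate (h + r 1_[0, k))] for
all [k], for some [h] and some nonzero [r]. This is impossible
([inflate_steps_not_compact]): at a weak cluster point [p] of this sequence the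
[n]-th ultrafilter limit is [h n + r], because [1_[0, k)] is eventually [1] at
[n]; but the limit along [U 0] of these coordinates is a bounded functional,
too, and it does not see the finitely supported [1_[0, k)], so that its value
at [p] is the limit of [h] and not that of [h + r]. *)

(** * Limits along an ultrafilter *)

(** A cluster point exists by compactness, and for an ultrafilter every cluster
point is a limit. *)
Lemma bounded_ultra_cvg (R : realType) (I : Type) (U : set_system I)
    (f : I -> R) (M : R) :
  UltraFilter U -> (forall i, `|f i| <= M) -> cvg (f @ U).
Proof.
move=> UU fM; have fU : (f @ U) `[- M, M]%classic.
  by apply: (@filterE _ U) => i; rewrite /preimage/= in_itv/= -ler_norml.
have [l [_ Ul]] := @segment_compact R (- M) M (f @ U) _ fU.
apply/cvg_ex; exists l => A lA.
have [//|UA] := in_ultra_setVsetC (f @^-1` A) UU.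
by have [x []] := Ul (~` A) A UA lA.
Qed.

Section ultralimit.
Context (R : realType) (U : set_system nat).
Context (UU : UltraFilter U).

Definition ulim (f : linf R nat) : R := lim ((f : nat -> R) @ U).

Lemma ulim_cvg (f : linf R nat) : (f : nat -> R) @ U --> ulim f.
Proof. exact: (bounded_ultra_cvg UU (linf_norm_ub f)). Qed.

Lemma ulim_eq (f : linf R nat) (l : R) : (f : nat -> R) @ U --> l -> ulim f = l.
Proof. by apply: cvg_lim; exact: Rhausdorff. Qed.

Lemma ulim_near (f : linf R nat) (l : R) :
  (\forall i \near U, f i = l) -> ulim f = l.
Proof. by move=> fl; apply: ulim_eq; exact: cvg_near_cst. Qed.

Lemma ulim_linear a f g : ulim (a *: f + g) = a * ulim f + ulim g.
Proof.
by apply: ulim_eq; exact: cvgD (cvgM (cvg_cst a) (@ulim_cvg f)) (@ulim_cvg g).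
Qed.

Lemma ulim_norm f : `|ulim f| <= `|f|.
Proof.
rewrite -(cvg_lim (@Rhausdorff R) (cvg_norm (@ulim_cvg f))).
apply: limr_le.
  by apply/cvg_ex; exists `|ulim f|; exact: cvg_norm (@ulim_cvg f).
by apply: nearW => i; exact: linf_norm_ub.
Qed.

Context (Uoo : U --> \oo).

Lemma ulim_c0 f : f \in @c0_pred R nat -> ulim f = 0.
Proof.
by move=> /c0_natP f0; apply: ulim_eq; apply: cvg_trans f0; exact: cvg_app.
Qed.

End ultralimit.

(** * Free ultrafilters on the fibres of an infinite-to-one map *)

(** Any map onto [nat] with infinite fibres would do. The exponent of 2 is taken
in [m.+1] to avoid 0, where [logn] has a default value. *)
Definition fiber_index (m : nat) : nat := logn 2 m.+1.

Lemma fiber_index_unbounded n N : exists2 m, (N <= m)%N & fiber_index m = n.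
Proof.
have p : (0 < 2 ^ n * (N.*2).+1)%N by rewrite muln_gt0 expn_gt0.
exists (2 ^ n * (N.*2).+1).-1%N.
  rewrite -ltnS prednK// (@leq_trans (N.*2).+1)//.
    by rewrite ltnS -addnn leq_addl.
  by rewrite leq_pmull// expn_gt0.
rewrite /fiber_index prednK// lognM ?expn_gt0// pfactorK//.
by rewrite logn_coprime ?addn0// coprime2n/= odd_double.
Qed.

Definition fiber_filter n : set_system nat :=
  within [set m | fiber_index m = n] \oo.

Lemma fiber_filter_proper n : ProperFilter (fiber_filter n).
Proof.
apply: Build_ProperFilter_ex => P; rewrite /fiber_filter/within/= => -[N _ NP].
by have [m Nm mn] := fiber_index_unbounded n N; exists m; exact: NP.
Qed.

Definition fiber_ultra n : set_system nat :=
  projT1 (cid (ultraFilterLemma (fiber_filter_proper n))).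

#[export] Instance fiber_ultraP n : UltraFilter (fiber_ultra n).
Proof. by rewrite /fiber_ultra; case: cid => ? []. Qed.

Lemma fiber_ultra_sub n : fiber_filter n `<=` fiber_ultra n.
Proof. by rewrite /fiber_ultra; case: cid => ? []. Qed.

Lemma fiber_ultra_oo n : fiber_ultra n --> \oo.
Proof. by move=> A ooA; apply: fiber_ultra_sub; apply: filterS ooA => m. Qed.

Lemma fiber_ultra_fiber n : \forall m \near fiber_ultra n, fiber_index m = n.
Proof. by apply: fiber_ultra_sub; exact: withinT. Qed.

(** * A quotient map onto the bounded sequences and its right inverse *)

Section operators.
Context (R : realType).
Implicit Types (f g h : linf R nat) (q : linf_c0 R nat).

Lemma linf_class_linear (I : Type) : linear (@linf_class R I).
Proof. by move=> a f g; rewrite linf_classD linf_classZ. Qed.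

HB.instance Definition _ (I : Type) :=
  GRing.isLinear.Build R _ _ _ (@linf_class R I) (@linf_class_linear I).

Lemma linf_class_norm (I : Type) (f : linf R I) : `|linf_class f| <= `|f|.
Proof. exact: linf_c0_norm_lb. Qed.

Lemma ulim_class (U : set_system nat) f g : UltraFilter U -> U --> \oo ->
  linf_class f = linf_class g -> ulim U f = ulim U g.
Proof.
move=> UU Uoo /linf_classP/(ulim_c0 UU Uoo) fg.
by rewrite -[f](subrK g) -[f - g]scale1r ulim_linear mul1r fg add0r.
Qed.

Lemma fiber_lim_bounded f :
  (fun n => ulim (fiber_ultra n) f) \in @bounded_pred R nat.
Proof. by apply/bounded_predP; exists `|f| => n; exact: ulim_norm. Qed.

(** The representative is immaterial by [ulim_class]; [fiber_limE] computes the
value on any class. *)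
Definition fiber_lim q : linf R nat := Linf (fiber_lim_bounded (repr q)).

Lemma fiber_limE f n : fiber_lim (linf_class f) n = ulim (fiber_ultra n) f.
Proof.
apply: ulim_class; first exact: fiber_ultra_oo.
by rewrite /linf_class reprK.
Qed.

Lemma fiber_lim_linear : linear fiber_lim.
Proof.
move=> a p q.
have [f ->] := linf_class_surj p; have [g ->] := linf_class_surj q.
apply/val_inj/funext => n; rewrite -linearP/= -[LHS]/(fiber_lim _ n).
by rewrite fiber_limE ulim_linear -!fiber_limE.
Qed.

HB.instance Definition _ :=
  GRing.isLinear.Build R _ _ _ fiber_lim fiber_lim_linear.

Lemma fiber_lim_norm q : `|fiber_lim q| <= `|q|.
Proof.
apply/ler_addgt0Pr => e e0.
have [f <- fe] := linf_c0_norm_adherent q e0.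
apply: le_trans (ltW fe); apply: linf_norm_le => // n.
by rewrite fiber_limE; exact: ulim_norm.
Qed.

Lemma inflate_bounded h : h \o fiber_index \in @bounded_pred R nat.
Proof.
apply/bounded_predP; exists `|h| => m.
exact: (linf_norm_ub h (fiber_index m)).
Qed.

Definition inflate h : linf_c0 R nat := linf_class (Linf (inflate_bounded h)).

Lemma inflate_linear : linear inflate.
Proof. by move=> a g h; rewrite -linearP; congr linf_class; exact/val_inj. Qed.

HB.instance Definition _ := GRing.isLinear.Build R _ _ _ inflate inflate_linear.

Lemma inflate_norm h : `|inflate h| <= `|h|.
Proof.
apply: le_trans (linf_class_norm _) _.
by apply: linf_norm_le => // m; exact: (linf_norm_ub h (fiber_index m)).
Qed.

Lemma inflateK : cancel inflate fiber_lim.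
Proof.
move=> h; apply/val_inj/funext => n; rewrite -[LHS]/(fiber_lim _ n) fiber_limE.
by apply: ulim_near; apply: filterS (fiber_ultra_fiber n) => m /= ->.
Qed.

End operators.

(** * Infinite sets outside countably many free ultrafilters *)

Lemma infinite_image_inj (T : Type) (e : nat -> T) :
  injective e -> infinite_set (range e).
Proof.
move=> ei; have /eq_finite_set -> : (range e #= [set: nat])%card.
  by apply: inj_card_eq => ? ? _ _; exact: ei.
exact: infinite_nat.
Qed.

Section branches.
Context (e : nat -> nat) (e_inj : injective e).

(** The branch of the infinite binary tree following [x]: the nodes, which are
the finite prefixes of [x], are numbered by [pickle] and placed by [e]. *)
Definition branch (x : nat -> bool) : set nat :=
  range (fun n => e (pickle (mkseq x n))).

Lemma branch_infinite x : infinite_set (branch x).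
Proof.
apply: infinite_image_inj => m n /e_inj/(pcan_inj pickleK)/(congr1 size).
by rewrite !size_mkseq.
Qed.

(** Two branches share only the nodes above their first difference. *)
Lemma branch_almost_disjoint x y : x <> y -> finite_set (branch x `&` branch y).
Proof.
move=> xy; have [i xyi] : exists i, x i != y i.
  apply: contrapT => /forallNP H; apply: xy; apply/funext => i.
  by apply/eqP; have /negP := H i; rewrite negbK.
have xi := finite_image (fun n => e (pickle (mkseq x n))) (finite_II i.+1).
apply: sub_finite_set xi.
move=> _ [[n _ <-] [m _ /e_inj/(pcan_inj pickleK) E]]; exists n => //=.
have := congr1 size E; rewrite !size_mkseq => mn; subst m.
rewrite ltnNge; apply/negP => ni.
have := congr1 (fun s => nth false s i) E.
by rewrite !nth_mkseq// => yx; move: xyi; rewrite yx eqxx.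
Qed.

(** A free ultrafilter contains at most one branch, by almost disjointness; a
sequence that differs from all these countably many exceptions is found by
Cantor's diagonal argument. *)
Lemma branch_avoid (U : nat -> set_system nat) :
  (forall n, UltraFilter (U n)) -> (forall n, U n --> \oo) ->
  exists x, forall n, U n (~` branch x).
Proof.
move=> UU Uoo.
(* [y n] is the sequence whose branch lies in [U n], if there is one. *)
pose y n : nat -> bool := xget (fun=> false) [set x | U n (branch x)].
exists (fun n => ~~ y n n) => n; set x := (fun _ => _).
have [Ux|//] := in_ultra_setVsetC (branch x) (UU n).
have Uy : U n (branch (y n)) by exact: (@xgetI _ _ [set x | U n (branch x)] x).
have xy : x <> y n by move/(congr1 (@^~ n)); rewrite /x; case: (y n n).
have /(Uoo n) Uf : \oo (~` (branch x `&` branch (y n))).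
  have /finite_seqP[s es] := branch_almost_disjoint xy.
  exists (\max_(i <- s) i).+1 => // m /= sm xm.
  have ms : [set` s] m by rewrite -es.
  by have := @leq_bigmax_seq _ s xpredT id m ms isT; rewrite leqNgt sm.
have UUn := UU n.
have Ub : U n (branch x `&` branch (y n)) by exact: filterI.
by have /filter_ex[m []] : U n (~` (branch x `&` branch (y n)) `&`
  (branch x `&` branch (y n))) by exact: filterI.
Qed.

End branches.

Lemma ultra_avoid (U : nat -> set_system nat) (A : set nat) :
  (forall n, UltraFilter (U n)) -> (forall n, U n --> \oo) ->
  infinite_set A -> exists A1, [/\ A1 `<=` A, infinite_set A1 &
    forall n, U n (~` A1)].
Proof.
move=> UU Uoo /infiniteP/pcard_leP[e].
have e_inj : injective e by move=> m n; apply: inj; rewrite inE.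
have [x Ux] := branch_avoid e_inj UU Uoo.
exists (branch e x); split => //; last exact: branch_infinite.
by move=> _ [n _ <-]; exact: funS.
Qed.

(** * The locally null surjection *)

Section locally_null_surjection.
Context (R : realType).

Definition fiber_lim_class : linf_c0 R nat -> linf_c0 R nat :=
  @linf_class R nat \o @fiber_lim R.

HB.instance Definition _ := GRing.Linear.copy fiber_lim_class
  (@linf_class R nat \o @fiber_lim R).

Lemma fiber_lim_zero_ext (A : set nat) (q : linf_c0 R A) :
  (forall n, fiber_ultra n (~` A)) -> fiber_lim (zero_ext_c0 R A q) = 0.
Proof.
move=> UA; have [f ->] := linf_class_surj q; rewrite zero_ext_c0E.
apply/val_inj/funext => n; rewrite -[LHS]/(fiber_lim _ n) fiber_limE.
by apply: ulim_near; apply: filterS (UA n) => m /= Am; rewrite zero_ext_notin.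
Qed.

Lemma fiber_lim_bounded_norm : bounded_fun_norm (@fiber_lim R).
Proof. by move=> r; exists r => q; apply: le_trans; exact: fiber_lim_norm. Qed.

Lemma linf_class_bounded_norm : bounded_fun_norm (@linf_class R nat).
Proof. by move=> r; exists r => f; apply: le_trans; exact: linf_class_norm. Qed.

Lemma fiber_lim_class_bounded : bounded_fun_norm fiber_lim_class.
Proof.
move=> r; have [M fM] := fiber_lim_bounded_norm r.
have [N cN] := linf_class_bounded_norm M.
by exists N => q /fM/cN.
Qed.

Lemma fiber_lim_class_locally_null : locally_null fiber_lim_class.
Proof.
move=> A Ainf.
have [A1 [A1A A1inf UA]] := ultra_avoid fiber_ultraP fiber_ultra_oo Ainf.
exists A1; split => //; apply/funext => q /=.
by rewrite /fiber_lim_class/= fiber_lim_zero_ext// linear0.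
Qed.

Lemma fiber_lim_class_factors : factors_through_linf fiber_lim_class.
Proof.
exists (@fiber_lim R), (@linf_class R nat); split => //.
- exact: fiber_lim_bounded_norm.
- exact: linf_class_bounded_norm.
Qed.

Lemma fiber_lim_class_surj : range fiber_lim_class = [set: linf_c0 R nat].
Proof.
apply/seteqP; split => // q _; have [f ->] := linf_class_surj q.
by exists (inflate f) => //; rewrite /fiber_lim_class/= inflateK.
Qed.

End locally_null_surjection.

(** * Completeness of the bounded functions and the Baire property *)

Section completeness.
Context (R : realType) (I : Type).

Lemma linf_complete (F : set_system (linf R I)) :
  ProperFilter F -> cauchy F -> cvg F.
Proof.
move=> FF /cauchyP Fc.
have /choice[g gP] i : exists l : R, (fun f : linf R I => f i) @ F --> l.
  apply/cvg_ex; apply: (@cauchy_cvg R^o); apply: cauchy_exP => e e0.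
  have [f Ff] := Fc e e0; exists (f i).
  change (F [set h : linf R I | ball (f i : R^o) e (h i)]).
  apply: filterS Ff => h /=.
  rewrite -!ball_normE /ball_/=; apply: le_lt_trans.
  exact: (linf_norm_ub (f - h) i).
(* The pointwise limit is as close to [f], uniformly, as the filter is. *)
have g_ball f d i : F (ball f d) -> `|f i - g i| <= d.
  move=> Ffd; apply/ler_addgt0Pr => e e0.
  have /cvgrPdist_lt/(_ e e0) gF := gP i.
  have /filter_ex[h [/= gh fh]] :
    F ([set h : linf R I | `|g i - h i| < e] `&` ball f d) by exact: filterI.
  rewrite (le_trans (ler_distD (h i) _ _))// lerD//; last by rewrite distrC ltW.
  move: fh; rewrite -ball_normE /ball_/= => /ltW; apply: le_trans.
  exact: (linf_norm_ub (f - h) i).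
have gb : g \in @bounded_pred R I.
  have [f Ff] := Fc 1 ltr01; apply/bounded_predP; exists (1 + `|f|) => i.
  rewrite -[g i](subrK (f i)) (le_trans (ler_normD _ _))// lerD ?linf_norm_ub//.
  by rewrite distrC g_ball.
apply/cvg_ex; exists (Linf gb); apply/cvgrPdist_le => e e0.
have d0 : 0 < e / 2 by rewrite divr_gt0.
have [f Ff] := Fc _ d0; apply: filterS (Ff) => h.
rewrite -ball_normE /ball_/= => fh.
rewrite -(subrK f (Linf gb)) -addrA (le_trans (ler_normD _ _))// [leRHS]splitr.
rewrite lerD ?(ltW fh)//; apply: linf_norm_le; first exact: ltW.
by move=> i; rewrite distrC; exact: g_ball.
Qed.

HB.instance Definition _ := Uniform_isComplete.Build (linf R I) linf_complete.

End completeness.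

Lemma closed_cover_ball (R : realType) (V : completeNormedModType R)
    (F : nat -> set V) :
  (forall n, closed (F n)) -> (forall x, exists n, F n x) ->
  exists n x, exists2 r, 0 < r & ball x r `<=` F n.
Proof.
move=> Fclosed Fcover.
apply: contrapT => H; have : dense (\bigcap_n ~` F n).
  apply: Baire => n; split; first exact: closed_openC.
  apply: contrapT => /denseNE[W [[x [Wo Wx]] WF]]; apply: H; exists n, x.
  have /nbhs_ballP[r r0 xr] : nbhs x W by apply: open_nbhs_nbhs.
  exists r => // z /xr Wz; apply: contrapT => Fz.
  by have : (W `&` ~` F n) z by []; rewrite WF.
move=> /(_ setT)[||x [_ xF]]; [by exists 0|exact: openT|].
by have [n /xF] := Fcover x; exact.
Qed.

(** * The weak topology *)

Section weak_topology.
Context (R : realType).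

Lemma bounded_linear_continuous (V W : normedModType R) (f : {linear V -> W}) :
  bounded_fun_norm f -> continuous f.
Proof. by move=> /bounded_landau/linear_continuous. Qed.

Lemma weak_continuous (V : normedModType R) (X : topologicalType) (f : X -> V) :
  (forall phi : dual V, continuous (fun x => sval phi (f x))) ->
  continuous (f : X -> weak V).
Proof.
move=> fphi; apply: continuous_comp_initial => x; apply/cvg_sup => phi.
have : continuous ((fun t (psi : dual V) => sval psi (f t)) : X ->
   initial_topology (@proj (dual V) (fun=> R^o) phi)).
  by apply: continuous_comp_initial; exact: fphi.
by move=> /(_ x).
Qed.

(** The level sets of a bounded functional are weakly closed, hence contain the
cluster points of every filter living on them. *)
Lemma weak_cluster_eq (V : normedModType R) (F : set_system (weak V)) (p : V)
    (phi : dual V) (c : R) :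
  cluster F p -> F [set x | sval phi x = c] -> sval phi p = c.
Proof.
move=> Fp Fc; have cl : closed ([set x | sval phi x = c] : set (weak V)).
  apply: (@preimage_closed (weak V) R^o (sval phi) [set c]).
    by move=> x _; exact: dual_weak_continuous.
  exact: closed_eq.
by apply: cl => A /(Fp _ _ Fc).
Qed.

End weak_topology.

(** * No weakly compact surjection *)

Section no_weakly_compact_surjection.
Context (R : realType).

Definition fiber_dual (mu : {linear linf R nat -> R^o})
    (mu_norm : forall f, `|mu f| <= `|f|) : dual (linf_c0 R nat).
Proof.
exists (mu \o @fiber_lim R) => r; exists r => q; apply: le_trans.
exact: le_trans (mu_norm _) (fiber_lim_norm _).
Defined.

Lemma fiber_dualE mu mu_norm q :
  sval (@fiber_dual mu mu_norm) q = mu (fiber_lim q).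
Proof. by []. Qed.

Definition linf_eval n (f : linf R nat) : R^o := f n.

HB.instance Definition _ n := GRing.isLinear.Build R _ R^o _ (linf_eval n)
  (fun _ _ _ => erefl).

Definition ulim0 (f : linf R nat) : R^o := ulim (fiber_ultra 0) f.

HB.instance Definition _ := GRing.isLinear.Build R _ R^o _ ulim0
  (ulim_linear (fiber_ultraP 0)).

Lemma step_bounded k : (fun i => (i < k)%N%:R) \in @bounded_pred R nat.
Proof.
by apply/bounded_predP; exists 1 => i; case: (i < k)%N; rewrite ?normr1 ?normr0.
Qed.

(** The indicator function of the first [k] indices. *)
Definition step k : linf R nat := Linf (step_bounded k).

Lemma step_norm k : `|step k| <= 1.
Proof.
by apply: linf_norm_le => // i /=; case: (i < k)%N; rewrite ?normr1 ?normr0.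
Qed.

Lemma step_c0 k : step k \in @c0_pred R nat.
Proof.
apply/c0_natP; apply: cvg_near_cst; exists k => // i /= ki.
by rewrite ltnNge ki.
Qed.

(** Both the coordinates of [fiber_lim] and their limit along an ultrafilter are
bounded functionals. Along the sequence in the statement each coordinate
eventually increases by [r], while the limit of the coordinates never does; a
weak cluster point would have to obey both. *)
Lemma inflate_steps_not_compact (K : set (weak (linf_c0 R nat)))
    (h : linf R nat) (r : R) :
  r != 0 -> (forall k, K (inflate (h + r *: step k))) -> ~ compact K.
Proof.
move=> r0 Kh cK.
pose y k : weak (linf_c0 R nat) := inflate (h + r *: step k).
have FK : (y @ \oo) K by apply: (@filterE _ \oo).
have [p [_ yp]] := cK (y @ \oo) _ FK.
have pE : forall n, fiber_lim p n = h n + r.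
  move=> n.
  rewrite -[LHS](@fiber_dualE (linf_eval n) (fun f => linf_norm_ub f n)).
  apply: (weak_cluster_eq yp); exists n.+1 => // k /= nk.
  rewrite -[LHS]/(fiber_lim (inflate (h + r *: step k)) n) inflateK.
  by rewrite -[LHS]/(h n + r * (n < k)%N%:R) nk mulr1.
have : ulim0 (fiber_lim p) = ulim0 h.
  rewrite -[LHS](@fiber_dualE ulim0 (ulim_norm (fiber_ultraP 0))).
  apply: (weak_cluster_eq yp); apply: (@filterE _ \oo) => k /=.
  rewrite -[LHS]/(ulim0 (fiber_lim (inflate (h + r *: step k)))) inflateK.
  have -> : ulim0 (h + r *: step k) = r * ulim0 (step k) + ulim0 h.
    by rewrite addrC linearP.
  by rewrite {1}/ulim0 (ulim_c0 _ _ (step_c0 k)) ?mulr0 ?add0r//;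
    exact: fiber_ultra_oo.
have : ulim0 (fiber_lim p) = ulim0 h + r.
  apply: ulim_eq; have -> : fiber_lim p = (fun n => h n + r) :> (nat -> R).
    exact/funext.
  by apply: cvgD; [exact: ulim_cvg|exact: cvg_cst].
by move=> -> /eqP; rewrite -subr_eq0 addrAC subrr add0r (negbTE r0).
Qed.

Lemma inflate_weakly_closed (K : set (weak (linf_c0 R nat))) (c : R) :
  closed K -> closed [set h | K (c *: inflate h)].
Proof.
apply: (@preimage_closed _ (weak (linf_c0 R nat)) (fun h => c *: inflate h)).
move=> x _; apply: weak_continuous => -[phi phib].
have -> : (fun h => phi (c *: inflate h)) = c \*: (phi \o @inflate R).
  by apply/funext => h /=; rewrite linearZ.
apply: bounded_linear_continuous => r; have [M phiM] := phib r.
exists (`|c| * M) => h hr; rewrite /= normrM ler_wpM2l//.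
by apply: phiM; exact: le_trans (inflate_norm _) hr.
Qed.

Lemma no_weakly_compact_surj (T : {linear linf_c0 R nat -> linf_c0 R nat}) :
  weakly_compact T -> range T <> [set: linf_c0 R nat].
Proof.
rewrite /weakly_compact; set K := closure _ => cK Tsurj.
pose F n := [set h : linf R nat | K (n.+1%:R^-1 *: inflate h)].
have Fclosed n : closed (F n).
  by apply: inflate_weakly_closed; exact: closed_closure.
have Fcover h : exists n, F n h.
  have [x _ xh] : range T (inflate h) by rewrite Tsurj.
  exists (Num.truncn `|x|); apply: subset_closure.
  exists ((Num.truncn `|x|).+1%:R^-1 *: x).
    rewrite /= normrZ ger0_norm// ler_pdivrMl// mulr1.
    exact/ltW/truncnS_gt.
  by rewrite linearZ/= xh.
have [n [x0 [r r0 xrF]]] := closed_cover_ball Fclosed Fcover.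
(* Half the radius, because the steps have norm up to 1 and the ball is open. *)
have [||//] :=
  @inflate_steps_not_compact K (n.+1%:R^-1 *: x0) (n.+1%:R^-1 * (r / 2)).
  by rewrite mulf_neq0// ?invr_eq0 ?pnatr_eq0// lt0r_neq0// divr_gt0.
move=> k; rewrite -scalerA -scalerDr linearZ/=; apply: xrF.
rewrite -ball_normE /ball_/= opprD addrA subrr add0r normrN normrZ.
rewrite gtr0_norm ?divr_gt0// (@le_lt_trans _ _ (r / 2))//.
  by rewrite ler_piMr ?step_norm// ltW ?divr_gt0.
by rewrite ltr_pdivrMr// ltr_pMr// ltr1n.
Qed.

End no_weakly_compact_surjection.

Theorem proposition3p3 (R : realType) :
  (exists T : {linear linf_c0 R nat -> linf_c0 R nat},
    [/\ bounded_fun_norm T, locally_null T, factors_through_linf T &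
        range T = [set: linf_c0 R nat]]) /\
  ~ (exists T : {linear linf_c0 R nat -> linf_c0 R nat},
    [/\ bounded_fun_norm T, weakly_compact T &
        range T = [set: linf_c0 R nat]]).
Proof.
split; last by move=> [T [_ /no_weakly_compact_surj]].
exists (@fiber_lim_class R); split.
- exact: fiber_lim_class_bounded.
- exact: fiber_lim_class_locally_null.
- exact: fiber_lim_class_factors.
- exact: fiber_lim_class_surj.
Qed.
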